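(* Let $p$ be an odd prime. Then $$\sum_{k=0}^{p-1}\binom{-\frac14}k^2(-8)^k\equiv\begin{cases}(-1)^{\frac{p-1}4}2x\pmod p&\text{if }p=x^2+y^2\equiv1\pmod4,\ 4\mid x-1,\\0\pmod p&\text{if }p\equiv3\pmod4,\end{cases}$$ and $$\sum_{k=0}^{p-1}\binom{-\frac14}k^2\frac1{(-8)^k}\equiv\begin{cases}(-1)^{\frac y4}2x\pmod p&\text{if }p=x^2+y^2\equiv1\pmod8,\ 4\mid x-1,\\(-1)^{\frac{y-2}4}2y\pmod p&\text{if }p=x^2+y^2\equiv5\pmod8,\ 2\nmid x,\\0\pmod p&\text{if }p\equiv3\pmod4,\end{cases}$$ where $x,y\in\mathbb Z$.
   Context: For rational $a$, $\binom ak=a(a-1)\cdots(a-k+1)/k!$. Congruences mod $p$ are among rationals with denominator coprime to $p$. *)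

(* Defs.v *)
From HB Require Import structures.
From mathcomp Require Import all_boot all_order all_algebra.
Set Implicit Arguments.
Unset Strict Implicit.
Unset Printing Implicit Defensive.
Import Order.TTheory GRing.Theory Num.Theory.
Local Open Scope ring_scope.

Definition rat_binomial (a : rat) (k : nat) : rat :=
  (\prod_(i < k) (a - i%:R)) / (k`!)%:R.

(* [denq a] is the positive denominator of [a] in lowest terms. *)
Definition integral_at (m : nat) (a : rat) : bool := coprimez (denq a) m%:Z.

(* Both sides must have denominator coprime to [m]; then the difference does
   too, and it lies in the ideal generated by [m] exactly when [m] divides its
   reduced numerator. *)
Definition rat_eqmod (m : nat) (a b : rat) : Prop :=
  [/\ integral_at m a, integral_at m b & (m%:Z %| numq (a - b))%Z].

(* Main.v *)
(* Let N in [0, p) with N = -1/4 mod p, m = (p - 1)/2, and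
   J(c) = sum_x (x/p) ((x^2 - c)/p).  Modulo p,
   C(N,k) C(N+k,k) (-4)^k = C(m,2k) C(2k,k), so the Legendre identity
   sum_k C(N,k)^2 z^k = sum_k C(N,k) C(N+k,k) z^k (1-z)^(N-k) at z = -8 turns
   the first sum into a coefficient of (x (x + 1) (x + 2))^m, that is, into
   - J(1) up to a nonzero factor; this vanishes when p = 3 mod 4.  The second
   sum is (-8)^(-N) times the first one.

   When p = 4 n + 1, J(1)^2 + J(g)^2 = 4 p for every nonresidue g, so J(1) and
   J(g) are +-2x and +-2y up to order, and J(c) = J(1) c^n mod p.  The signs,
   and the value of 2^n, come from counting the t such that t and 1 - t lie in
   a given coset of the fourth powers: the count is odd iff 1/2 is in that
   coset, because t -> 1 - t is an involution, and 16 times the count is an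
   explicit combination of p, J(1) and J(2). *)
Require Import Defs.
From HB Require Import structures.
From mathcomp Require Import all_boot all_order all_algebra.
From mathcomp Require Import cyclic finfield ring zify.
Set Implicit Arguments.
Unset Strict Implicit.
Unset Printing Implicit Defensive.
Import Order.TTheory GRing.Theory Num.Theory.
Local Open Scope ring_scope.

(** * Sums over finite fields and the quadratic character *)

Lemma card_finField_gt1 (F : finFieldType) : (1 < #|F|)%N.
Proof. exact: finNzRing_gt1. Qed.

Lemma card_finField_neq0 (F : finFieldType) : #|[pred x : F | x != 0]| = #|F|.-1.
Proof. by rewrite -(cardC1 (0 : F)); apply: eq_card => x; rewrite !inE. Qed.

(** Translation by 1 permutes [F], so adding [#|F|] ones does not change the sum of all elements. *)
Lemma card_finField_natr (F : finFieldType) : #|F|%:R = 0 :> F.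
Proof.
have inj : injective (fun x : F => x + 1) by apply: addIr.
have := reindex_inj (inj) (P := predT) (F := fun x : F => x) (op := +%R).
move/(_ 0) => /= /esym; rewrite big_split /= sumr_const.
by move/eqP; rewrite -subr_eq0 addrAC subrr add0r => /eqP.
Qed.

Lemma finField_exists_prim_root (F : finFieldType) :
  exists z : F, (#|F|.-1).-primitive_root z.
Proof.
have F_gt1 := card_finField_gt1 F.
pose rs := enum [pred x : F | x != 0].
have n_gt0 : (0 < #|F|.-1)%N by lia.
have rsroot : all (#|F|.-1).-unity_root rs.
  apply/allP => x; rewrite mem_enum inE => x0.
  rewrite unity_rootE; apply/eqP/(mulfI x0); rewrite mulr1 -exprS prednK ?expf_card // (ltnW F_gt1) //.
have/hasP[z _ zP] : has (#|F|.-1).-primitive_root rs.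
  apply: has_prim_root n_gt0 rsroot (enum_uniq _) _.
  by rewrite -cardE card_finField_neq0.
by exists z.
Qed.

(** For a generator [z], multiplication by [z] permutes [F] and scales the sum by [z ^+ k], which is
    1 only if [#|F|.-1] divides [k]. The bound leaves just the multiples 0 and [#|F|.-1]; at 0 the
    convention 0^0 = 1 turns the sum into [#|F|], which is 0 in [F]. *)
Lemma sum_expr_finField (F : finFieldType) (k : nat) :
  (k < 2 * #|F|.-1)%N ->
  \sum_(x : F) x ^+ k = if k == #|F|.-1 then -1 else 0.
Proof.
have F_gt1 := card_finField_gt1 F.
have n0 : (#|F|.-1 == 0)%N = false by lia.
move=> k_lt; case: eqP => [->|kN].
  rewrite (bigD1 0) //= expr0n n0 add0r.
  rewrite (eq_bigr (fun _ => 1)) => [|x x0]; last first.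
    by apply: (mulfI x0); rewrite mulr1 -exprS prednK ?expf_card // (ltnW F_gt1) //.
  rewrite sumr_const card_finField_neq0; apply/eqP.
  rewrite -subr_eq0 opprK -mulrSr prednK ?card_finField_natr //; exact: ltnW.
case: (posnP k) => [->|k_gt0].
  by under eq_bigr do rewrite expr0; rewrite sumr_const card_finField_natr.
have [z zP] := finField_exists_prim_root F.
have zk : z ^+ k != 1.
  rewrite -(prim_order_dvd zP); apply/negP => /dvdnP[i ki].
  by move: kN k_lt k_gt0; rewrite ki; case: i {ki} => [|[|i]]; nia.
have z0 : z != 0.
  apply: contra_eq_neq (prim_expr_order zP) => ->.
  by rewrite expr0n n0 eq_sym oner_neq0.
apply/eqP; have := reindex_inj (mulfI z0) (P := predT) (F := fun x : F => x ^+ k) (op := +%R) (x := 0).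
move=> /= /eqP.
under [X in _ == X]eq_bigr do rewrite exprMn.
rewrite -mulr_sumr -subr_eq0 -{1}[\sum__ _]mul1r -mulrBl mulf_eq0 subr_eq0 eq_sym.
by rewrite (negbTE zk).
Qed.

Lemma sum_horner_finField (F : finFieldType) (P : {poly F}) :
  (size P <= 2 * #|F|.-1)%N -> \sum_(x : F) P.[x] = - P`_(#|F|.-1).
Proof.
have F_gt1 := card_finField_gt1 F.
move=> sP; under eq_bigr do rewrite (horner_coef_wide _ sP).
rewrite exchange_big /=.
have qlt : (#|F|.-1 < 2 * #|F|.-1)%N by lia.
rewrite (bigD1 (Ordinal qlt)) //= -mulr_sumr sum_expr_finField // eqxx mulrN1.
rewrite big1 ?addr0 // => i iN; rewrite -mulr_sumr sum_expr_finField //.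
case: eqP => [ei|]; last by rewrite mulr0.
by case/eqP: iN; apply: val_inj.
Qed.

Lemma sum_const_neq (F : finFieldType) (u : F) (k : int) :
  \sum_(a | a != u) k = (#|F|%:Z - 1) * k.
Proof.
have : \sum_(a : F) k = #|F|%:Z * k by rewrite sumr_const -mulr_natl natz.
by rewrite (bigD1 u) //= => /(canRL (addKr _)) ->; ring.
Qed.

(** Euler's criterion serves as definition. The values lie in [int] rather than in [F], so that
    character sums are genuine integers, comparable with [#|F|]. *)
Definition qchar (F : finFieldType) (x : F) : int :=
  if x == 0 then 0 else if x ^+ #|F|./2 == 1 then 1 else -1.

Section QuadraticCharacter.
Variable F : finFieldType.
Hypothesis F_odd : odd #|F|.
Implicit Types x y a b c : F.

Let m := #|F|./2.

Lemma card_half : #|F| = (2 * m).+1.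
Proof. by rewrite -[LHS]odd_double_half F_odd -/m; lia. Qed.

Lemma half_gt0 : (0 < m)%N.
Proof. by have := card_finField_gt1 F; rewrite card_half; lia. Qed.

Lemma two_neq0 : 2%:R != 0 :> F.
Proof.
apply/eqP => h; have := card_finField_natr F.
rewrite card_half -addn1 natrD natrM h mul0r add0r => /eqP; by rewrite oner_eq0.
Qed.

Lemma neq_N1 : -1 != 1 :> F.
Proof. by rewrite -subr_eq0 -opprD oppr_eq0 -(natrD _ 1 1) two_neq0. Qed.

Lemma expf_half x : x != 0 -> x ^+ m = 1 \/ x ^+ m = -1.
Proof.
move=> x0; have : (x ^+ m) ^+ 2 = 1.
  by apply: (mulfI x0); rewrite mulr1 -exprM mulnC -exprS -card_half expf_card.
by move/eqP; rewrite sqrf_eq1 => /orP[] /eqP ->; [left|right].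
Qed.

Lemma qchar0 : qchar (0 : F) = 0.
Proof. by rewrite /qchar eqxx. Qed.

Lemma qchar1 : qchar (1 : F) = 1.
Proof. by rewrite /qchar oner_eq0 expr1n eqxx. Qed.

Lemma qchar_expr x : (qchar x)%:~R = x ^+ m.
Proof.
rewrite /qchar; case: eqP => [->|/eqP x0].
  by rewrite expr0n; case: m half_gt0.
by rewrite -/m; case: (expf_half x0) => ->; rewrite ?eqxx ?(negbTE neq_N1).
Qed.

Lemma qchar_cases x : x != 0 -> qchar x = 1 \/ qchar x = -1.
Proof. by rewrite /qchar => /negbTE->; case: ifP; [left|right]. Qed.

Lemma qchar_neq0 x : x != 0 -> qchar x ^+ 2 = 1.
Proof. by move=> x0; case: (qchar_cases x0) => ->. Qed.

Lemma qchar_eq1 x : x != 0 -> (qchar x == 1) = (x ^+ m == 1).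
Proof. by rewrite /qchar => /negbTE ->; rewrite -/m; case: ifP. Qed.

Lemma qcharM x y : qchar (x * y) = qchar x * qchar y.
Proof.
have [->|x0] := eqVneq x 0; first by rewrite mul0r qchar0 mul0r.
have [->|y0] := eqVneq y 0; first by rewrite mulr0 qchar0 mulr0.
rewrite /qchar mulf_eq0 (negbTE x0) (negbTE y0) /=.
rewrite exprMn -/m; case: (expf_half x0) => ->; case: (expf_half y0) => ->;
 by rewrite ?mulr1 ?mul1r ?mulN1r ?opprK ?eqxx ?(negbTE neq_N1).
Qed.

Lemma qchar_sqr x : x != 0 -> qchar (x ^+ 2) = 1.
Proof. by move=> x0; rewrite qcharM -expr2 qchar_neq0. Qed.

Lemma qcharV x : qchar x^-1 = qchar x.
Proof.
have [->|x0] := eqVneq x 0; first by rewrite invr0.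
have : qchar x * qchar x^-1 = 1 by rewrite -qcharM mulfV // qchar1.
have xV0 : x^-1 != 0 by rewrite invr_eq0.
by case: (qchar_cases x0) => ->; case: (qchar_cases xV0) => ->.
Qed.

Lemma qchar1P x : qchar x = 1 -> exists2 y, y != 0 & x = y ^+ 2.
Proof.
have [->|x0] := eqVneq x 0; first by rewrite qchar0.
move/eqP; rewrite qchar_eq1 // => /eqP xm.
have [z zP] := finField_exists_prim_root F.
move: zP; rewrite card_half /= => zP.
have [i xi] : {i : 'I_(2 * m) | x = z ^+ i}.
  by apply: (prim_rootP zP); rewrite mulnC exprM xm expr1n.
(* [x ^+ m = 1] makes [2 * m] divide [i * m], hence [i] is even. *)
move: xm; rewrite xi -exprM => /eqP; rewrite -(prim_order_dvd zP) dvdn_pmul2r ?half_gt0 //.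
case/dvdnP => j ij; exists (z ^+ j); last by rewrite ij exprM.
by apply: contraNneq x0 => zj0; rewrite xi ij exprM zj0 expr0n.
Qed.

Lemma card_sqr_roots x : #|[pred y | y ^+ 2 == x]|%:Z = 1 + qchar x.
Proof.
have [->|x0] := eqVneq x 0.
  rewrite qchar0 (@eq_card1 _ (0:F)) // => y.
  by rewrite !inE sqrf_eq0.
have [q1|qN1] := qchar_cases x0.
  have [y y0 xy] := qchar1P q1.
  rewrite q1 (@eq_card _ _ (pred2 y (- y))) => [|u].
    rewrite card2 -[y == _]subr_eq0 opprK -mulr2n -mulr_natr mulf_eq0 (negbTE y0).
    by rewrite (negbTE two_neq0).
  by rewrite !inE xy eqf_sqr.
rewrite qN1 eq_card0 // => y; rewrite !inE; apply/negP => /eqP yx.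
have y0 : y != 0 by apply: contraNneq x0 => y0; rewrite -yx y0 expr0n.
by move: qN1; rewrite -yx qchar_sqr.
Qed.

Lemma sum_sqr (f : F -> int) :
  \sum_b f (b ^+ 2) = \sum_a f a * (1 + qchar a).
Proof.
rewrite (partition_big (fun b => b ^+ 2) predT) //=; apply: eq_bigr => a _.
rewrite (eq_bigr (fun _ => f a)) => [|b /eqP-> //].
by rewrite sumr_const -card_sqr_roots -mulr_natr natz.
Qed.

Lemma sum_qchar : \sum_(x : F) qchar x = 0.
Proof.
have := sum_sqr (fun _ => 1); rewrite sumr_const.
under eq_bigr do rewrite mul1r.
by rewrite big_split /= sumr_const => /esym/eqP; rewrite -subr_eq0 addrAC subrr add0r => /eqP.
Qed.

Lemma exists_qcharN1 : exists g : F, qchar g = -1.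
Proof.
have [/existsP[g /eqP gP]|/existsPn h] := boolP [exists g : F, qchar g == -1]; first by exists g.
have := sum_qchar; rewrite (bigD1 0) //= qchar0 add0r.
rewrite (eq_bigr (fun _ => 1)) => [|x x0].
  by rewrite sumr_const natz card_finField_neq0 card_half; have := half_gt0; case: m.
by case: (qchar_cases x0) => // q; move: (h x); rewrite q.
Qed.

End QuadraticCharacter.

(** * Jacobsthal sums *)

(** In odd characteristic and for nonzero [c], this is minus the trace of Frobenius of the curve y^2
    = x^3 - c x. *)
Definition jacobsthal (F : finFieldType) (c : F) : int :=
  \sum_(x : F) qchar x * qchar (x ^+ 2 - c).

Section CharacterSums.
Variable F : finFieldType.
Hypothesis F_odd : odd #|F|.
Implicit Types (x y a b c d t u v e g : F).

Lemma sum_qchar_shift c : \sum_x qchar (x + c) = 0.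
Proof.
have h := reindex_inj (addIr c) (P := predT) (F := fun x : F => qchar x) (op := +%R) (x := 0).
by rewrite -h sum_qchar.
Qed.

Lemma sum_qchar_pair u v :
  \sum_a qchar ((u - a) * (v - a)) = (if u == v then #|F|%:Z else 0) - 1.
Proof.
case: eqP => [<-|/eqP uv].
  rewrite (bigD1 u) //= subrr mul0r qchar0 add0r.
  rewrite (eq_bigr (fun _ => 1)) => [|a au]; last by rewrite -expr2 qchar_sqr // subr_eq0 eq_sym.
  by rewrite sum_const_neq mulr1.
(* Putting a = u - d / c turns the product into (d / c)^2 (c + 1). Since 1 / 0 = 0, this is a
   bijection of all of [F]: c = 0 corresponds to a = u, where the summand is 0 although
   [qchar (c + 1)] is 1, hence the final -1. *)
pose d := v - u; have d0 : d != 0 by rewrite subr_eq0 eq_sym.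
have dinj : injective (fun c : F => u - d / c).
  by move=> x y /addrI/oppr_inj/(mulfI d0)/invr_inj.
rewrite (reindex_inj dinj) (bigD1 0) //= invr0 mulr0 !subr0 subrr mul0r qchar0 !add0r.
have := sum_qchar_shift 1; rewrite (bigD1 0) //= add0r qchar1.
rewrite (eq_bigr (fun c : F => qchar ((u - (u - d / c)) * (v - (u - d / c))))) => [|c c0].
  by move/eqP; rewrite addrC addr_eq0 => /eqP.
have -> : (u - (u - d / c)) * (v - (u - d / c)) = (d / c) ^+ 2 * (c + 1).
  by rewrite /d; field.
by rewrite (qcharM F_odd) (qchar_sqr F_odd) ?mul1r // mulf_neq0 ?invr_eq0.
Qed.

Lemma sum_qchar_sqrB1 : \sum_(x : F) qchar (x ^+ 2 - 1) = -1.
Proof.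
have := sum_qchar_pair 1 (-1); rewrite eq_sym (negbTE (neq_N1 F_odd)) sub0r => <-.
by apply: eq_bigr => x _; congr qchar; ring.
Qed.

Lemma jacobsthal0 : jacobsthal (0 : F) = 0.
Proof.
rewrite -(sum_qchar F_odd); apply: eq_bigr => x _; rewrite subr0.
by have [->|x0] := eqVneq x 0; rewrite ?qchar0 ?mul0r // (qchar_sqr F_odd) // mulr1.
Qed.

Lemma jacobsthal_twist c b : b != 0 -> jacobsthal (c * b ^+ 2) = qchar b * jacobsthal c.
Proof.
move=> b0; rewrite /jacobsthal (reindex_inj (mulfI b0)) mulr_sumr.
apply: eq_bigr => x _ /=; rewrite exprMn mulrC [c * _]mulrC -mulrBr.
by rewrite !(qcharM F_odd) -expr2 (qchar_neq0 b0) mul1r; ring.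
Qed.

Hypothesis qcharN1 : qchar (-1 : F) = 1.

Lemma qcharN x : qchar (- x) = qchar x.
Proof. by rewrite -mulN1r (qcharM F_odd) qcharN1 mul1r. Qed.

(** Expand the square and sum over [c] first: the nonconstant part of [sum_qchar_pair] survives only
    for [y = x] and [y = - x], where [qchar x * qchar y = 1] for nonzero [x] because -1 is a
    square. *)
Lemma sum_jacobsthal_sqr : \sum_(c : F) jacobsthal c ^+ 2 = 2 * #|F|%:Z * (#|F|%:Z - 1).
Proof.
have E c : jacobsthal c ^+ 2 =
    \sum_x \sum_y qchar x * qchar y * qchar ((x ^+ 2 - c) * (y ^+ 2 - c)).
  rewrite expr2 /jacobsthal mulr_suml; apply: eq_bigr => x _; rewrite mulr_sumr.
  by apply: eq_bigr => y _; rewrite (qcharM F_odd); ring.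
rewrite (eq_bigr _ (fun c _ => E c)) exchange_big /=.
have Ex x : \sum_c \sum_y qchar x * qchar y * qchar ((x ^+ 2 - c) * (y ^+ 2 - c))
   = if x == 0 then 0 else 2 * #|F|%:Z.
  rewrite exchange_big /=.
  under eq_bigr do rewrite -mulr_sumr sum_qchar_pair mulrBr mulr1.
  rewrite sumrB -mulr_sumr (sum_qchar F_odd) mulr0 subr0.
  case: eqP => [->|/eqP x0]; first by rewrite big1 // => y _; rewrite qchar0 !mul0r.
  rewrite (bigID [pred y : F | y ^+ 2 == x ^+ 2]) /= [X in _ + X]big1 => [|y /negbTE]; last first.
    by rewrite eq_sym => ->; rewrite mulr0.
  rewrite addr0 (eq_bigr (fun _ => #|F|%:Z)) => [|y].
    rewrite sumr_const -[LHS]mulr_natl; congr (_ * _).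
    by rewrite natz (card_sqr_roots F_odd) (qchar_sqr F_odd).
  rewrite eq_sym => xy; rewrite xy.
  suff -> : qchar y = qchar x by rewrite -expr2 (qchar_neq0 x0) mul1r.
  by move: xy; rewrite eq_sym eqf_sqr => /orP[] /eqP -> //; rewrite qcharN.
rewrite (eq_bigr _ (fun x _ => Ex x)) (bigD1 0) //= eqxx add0r.
rewrite (eq_bigr (fun _ => 2 * #|F|%:Z)) => [|x /negbTE-> //].
by rewrite sum_const_neq mulrC.
Qed.

(* Half of the nonzero c are squares b^2, the others are g b^2, and J(d b^2)^2 is
   J(d)^2: so the mean square above is half of J(1)^2 + J(g)^2. *)
Lemma jacobsthal_two_squares g : qchar g = -1 -> jacobsthal (1 : F) ^+ 2 + jacobsthal g ^+ 2 = 4 * #|F|%:Z.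
Proof.
move=> qg.
have g0 : g != 0 by apply/eqP => g0; move: qg; rewrite g0 qchar0.
have S d : \sum_(c : F) jacobsthal (d * c) ^+ 2 * (1 + qchar c) = (#|F|%:Z - 1) * jacobsthal d ^+ 2.
  rewrite -(sum_sqr F_odd (fun c => jacobsthal (d * c) ^+ 2)) (bigD1 0) //= expr0n mulr0 jacobsthal0 add0r.
  rewrite (eq_bigr (fun _ => jacobsthal d ^+ 2)) => [|b b0].
    by rewrite sum_const_neq.
  by rewrite jacobsthal_twist // exprMn (qchar_neq0 b0) mul1r.
have := S 1; under eq_bigr => c _ do rewrite mul1r.
move=> S1; have := S g.
rewrite (reindex_inj (mulfI (invr_neq0 g0))) /=.
under eq_bigr => c _ do rewrite mulrA mulfV // mul1r (qcharM F_odd) (qcharV F_odd) qg mulN1r.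
move=> Sg; have := sum_jacobsthal_sqr.
have : \sum_(c : F) jacobsthal c ^+ 2 * (1 + qchar c) + \sum_(c : F) jacobsthal c ^+ 2 * (1 - qchar c)
   = 2 * \sum_(c : F) jacobsthal c ^+ 2.
  by rewrite -big_split mulr_sumr; apply: eq_bigr => c _ /=; ring.
rewrite S1 Sg; move=> E1 E2; move: E1; rewrite E2.
have := card_finField_gt1 F.
set X := jacobsthal (1 : F); set Y := jacobsthal g; move: #|F| X Y; nia.
Qed.

End CharacterSums.

(** * Cosets of fourth powers and points on a conic *)

Section Conic.
Variable F : finFieldType.
Hypothesis F_odd : odd #|F|.
Implicit Types (x y a b c d t u v e g h w i : F).

(** The involution [t -> 1 - t] fixes only 1/2; all other terms come in equal pairs. *)
Lemma sum_reflection (f : F -> int) :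
  (forall t, f (1 - t) = f t) -> exists k : int, \sum_t f t = 2 * k + f (2^-1).
Proof.
move=> fE; have n2 := two_neq0 F_odd.
have half t : (t == 1 - t) = (t == 2^-1).
  rewrite -[RHS](inj_eq (mulfI n2)) divff // -subr_eq0 -[RHS]subr_eq0; congr (_ == _); ring.
(* [r] selects one element of each pair by its position in the enumeration of [F]. *)
pose r t := (enum_rank t < enum_rank (1 - t)%R)%N.
exists (\sum_(t | r t) f t).
rewrite (bigD1 2^-1) //= addrC; congr (_ + _); rewrite (bigID r) /=.
have -> : \sum_(t | (t != 2^-1) && ~~ r t) f t = \sum_(t | r t) f t.
  have inv1 : involutive (fun t => 1 - t) by move=> t; ring.
  rewrite (reindex_inj (inv_inj inv1)) /=; apply: eq_big => [t|t _]; last exact: fE.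
  rewrite /r subKr -half subKr eq_sym; have [<-|ne] := eqVneq; first by rewrite ltnn.
  rewrite -leqNgt leq_eqVlt (inj_eq val_inj) (inj_eq enum_rank_inj).
  by rewrite (negbTE ne).
rewrite mulr_natl mulr2n; congr (_ + _); apply: eq_bigl => t.
by rewrite -half /r; have [<-|] := eqVneq; rewrite ?ltnn.
Qed.

Variable i : F.
Hypothesis i2 : i ^+ 2 = -1.

Lemma i_neq0 : i != 0.
Proof.
by apply/eqP => i0; move/eqP: i2; rewrite i0 expr0n /= eq_sym oppr_eq0 oner_eq0.
Qed.

Lemma qcharN1_sqrt : qchar (-1 : F) = 1.
Proof. by rewrite -i2 (qchar_sqr F_odd) // i_neq0. Qed.

Variable e : F.
Hypothesis e0 : e != 0.

Definition conic (f : F -> F -> int) : int :=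
  \sum_a \sum_(w | e * a ^+ 2 + e * w ^+ 2 == 1) f a w.

(* The conic is (a + i w) (a - i w) = 1/e, and h is a + i w. *)
Lemma conic_param (f : F -> F -> int) :
  conic f = \sum_(h | h != 0) f ((h + (e * h)^-1) / 2) ((h - (e * h)^-1) / (2 * i)).
Proof.
have n2 := two_neq0 F_odd; have n0 := i_neq0.
rewrite /conic pair_big_dep /=.
rewrite (reindex_onto (fun h => ((h + (e * h)^-1) / 2, (h - (e * h)^-1) / (2 * i)))
  (fun p => p.1 + i * p.2)) /=; last first.
  move=> [a w] /= /eqP E.
  have E2 : e * (a + i * w) * (a - i * w) = 1.
    have -> : e * (a + i * w) * (a - i * w) = e * a ^+ 2 - i ^+ 2 * (e * w ^+ 2) by ring.
    by rewrite i2 mulN1r opprK.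
  have -> : (e * (a + i * w))^-1 = a - i * w.
    have nz : e * (a + i * w) != 0 by apply/eqP => z; move/eqP: E2; rewrite z mul0r eq_sym oner_eq0.
    by apply: (mulfI nz); rewrite divff.
  by congr pair; field; rewrite ?n2 ?n0.
apply: eq_bigl => h.
have [->|h0] := eqVneq h 0.
  by rewrite mulr0 invr0 addr0 subr0 !mul0r expr0n /= !mulr0 addr0 eq_sym oner_eq0.
apply: (introT andP); split; apply/eqP; last by field; rewrite ?n2 ?n0 ?e0 ?h0.
have n4 : 4 != 0 :> F by rewrite (natrM F 2 2) mulf_neq0.
by rewrite !expr_div_n exprMn i2; field; rewrite oppr_eq0 n4 e0 h0.
Qed.

Lemma conic_count : conic (fun _ _ => 1) = #|F|%:Z - 1.
Proof. by rewrite conic_param sum_const_neq mulr1. Qed.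

(** For fixed [a] the number of [w] is 1 + [qchar (e^-1 - a ^+ 2)], and the sign inside is
    immaterial since -1 is a square. This gives [jacobsthal e^-1], and [e^-1] is [e] times a
    square. *)
Lemma conic_fst : conic (fun a _ => qchar a) = qchar e * jacobsthal e.
Proof.
have -> : qchar e * jacobsthal e = jacobsthal e^-1.
  have -> : e^-1 = e * e^-1 ^+ 2 by field.
  by rewrite (jacobsthal_twist F_odd) ?invr_eq0 // (qcharV F_odd).
transitivity (\sum_a (qchar a + qchar a * qchar (a ^+ 2 - e^-1))); last first.
  by rewrite big_split /= (sum_qchar F_odd) add0r.
apply: eq_bigr => a _.
rewrite sumr_const -mulr_natr natz -{2}[qchar a]mulr1 -mulrDr; congr (_ * _).
rewrite -(qcharN F_odd qcharN1_sqrt) opprB -(card_sqr_roots F_odd).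
congr Posz; apply: eq_card => w; rewrite inE -[LHS]/(e * a ^+ 2 + e * w ^+ 2 == 1).
rewrite -[RHS](inj_eq (mulfI e0)) mulrBr divff // -[LHS]subr_eq0 -[RHS]subr_eq0.
by congr (_ == _); ring.
Qed.

Lemma conic_snd : conic (fun _ w => qchar w) = qchar e * jacobsthal e.
Proof.
rewrite -conic_fst /conic (exchange_big_dep predT) //=.
by apply: eq_bigr => w _; apply: eq_bigl => a; rewrite addrC.
Qed.

(** In the parameter [h], the product [a * w] equals i (e^2 h^4 - 1) up to the square of 2 i e h.
    What remains is a sum over b = h^2, to which [sum_sqr] applies. *)
Lemma conic_mul :
  conic (fun a w => qchar a * qchar w) = qchar i * (qchar e * jacobsthal (1 : F) - 2).
Proof.
have n2 := two_neq0 F_odd; have n0 := i_neq0.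
rewrite conic_param.
rewrite (eq_bigr (fun h => qchar i * qchar (e ^+ 2 * (h ^+ 2) ^+ 2 - 1))) => [|h h0]; last first.
  rewrite -!(qcharM F_odd) -[LHS]mul1r.
  have <- : qchar ((2 * i * e * h) ^+ 2) = 1.
    by rewrite (qchar_sqr F_odd) // !mulf_neq0.
  by rewrite -(qcharM F_odd); congr qchar; field; rewrite ?n2 ?n0 ?e0 ?h0.
rewrite -mulr_sumr; congr (_ * _).
have S := sum_sqr F_odd (fun b => qchar (e ^+ 2 * b ^+ 2 - 1)).
have : \sum_b qchar (e ^+ 2 * b ^+ 2 - 1) * (1 + qchar b) = -1 + qchar e * jacobsthal (1 : F).
  rewrite (reindex_inj (mulfI (invr_neq0 e0))) /=.
  rewrite -(sum_qchar_sqrB1 F_odd) /jacobsthal mulr_sumr -big_split; apply: eq_bigr => b _ /=.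
  rewrite (qcharM F_odd) (qcharV F_odd).
  have -> : e ^+ 2 * (e^-1 * b) ^+ 2 = b ^+ 2 by field.
  by ring.
(* The value h = 0 does not parametrize a point; removing its term [qchar (-1) = 1] changes -1 into
   -2. *)
rewrite -S (bigD1 0) //= expr0n /= expr0n mulr0 sub0r qcharN1_sqrt => E.
by apply: (addrI 1); rewrite E; ring.
Qed.

(** The weight vanishes unless each of [a] and [w] is 0 or has quadratic character [s]; its four
    terms, once expanded, are the four sums above. *)
Lemma conic_weighted (s : int) : s ^+ 2 = 1 ->
  conic (fun a w => (1 + s * qchar a) * (1 + s * qchar w)) =
    #|F|%:Z - 1 + 2 * s * (qchar e * jacobsthal e) + qchar i * (qchar e * jacobsthal (1 : F) - 2).
Proof.
move=> s2; rewrite -conic_count -conic_mul.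
have -> : 2 * s * (qchar e * jacobsthal e) =
   s * conic (fun a _ => qchar a) + s * conic (fun _ w => qchar w).
  by rewrite conic_fst conic_snd; ring.
rewrite /conic !mulr_sumr -!big_split; apply: eq_bigr => a _ /=.
rewrite !mulr_sumr -!big_split; apply: eq_bigr => w _ /=.
have -> : (1 + s * qchar a) * (1 + s * qchar w) =
  1 + s * qchar a + s * qchar w + s ^+ 2 * (qchar a * qchar w) by ring.
by rewrite s2; ring.
Qed.

Variables (n : nat) (s : int).
Hypothesis card_4n : #|F| = (4 * n).+1.
Hypothesis s2 : s ^+ 2 = 1.

(** Among nonzero elements, the kernel of raising to the power [n] consists of the fourth powers, so
    [k] designates one of their four cosets. *)
Let k := s%:~R * e ^+ n.

Lemma half_4n : #|F|./2 = (n * 2)%N.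
Proof. by rewrite card_4n; lia. Qed.

(* For t <> 0, t^n = s e^n iff t = e a^2 for some a with qchar a = s, and then
   there are two such a. *)
Lemma sum_fiber t :
  \sum_(a | e * a ^+ 2 == t) (1 + s * qchar a) =
    if t == 0 then 1 else 4 * (t ^+ n == k)%:Z.
Proof.
have s2F : s%:~R ^+ 2 = 1 :> F by rewrite -rmorphXn /= s2.
have et a : (e * a ^+ 2 == t) = (a ^+ 2 == t / e).
  by rewrite -[RHS](inj_eq (mulfI e0)) [e * (t / e)]mulrC divfK.
rewrite (eq_bigl _ _ et) => {et}.
have [->|t0] := eqVneq t 0.
  rewrite mul0r (eq_bigl (pred1 0)) => [|a]; last by rewrite /= sqrf_eq0.
  by rewrite big_pred1_eq qchar0 mulr0 addr0.
have te0 : t / e != 0 by rewrite mulf_neq0 ?invr_eq0.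
have tk : (t ^+ n == k) = ((t / e) ^+ n == s%:~R).
  rewrite /k expr_div_n -[RHS](inj_eq (mulIf (expf_neq0 n e0))) divfK //.
  exact: expf_neq0.
rewrite tk; have [q1|qN1] := qchar_cases te0; last first.
  rewrite big_pred0 => [|a].
    case: eqP => [E|//]; move/eqP: qN1.
    suff /eqP-> : qchar (t / e) == 1 by [].
    by rewrite (qchar_eq1 te0) half_4n exprM E s2F.
  apply/negP => /eqP E; move: te0 qN1; rewrite -E => te0; rewrite (qchar_sqr F_odd) //.
  by apply: contraNneq te0 => ->; rewrite expr0n.
have [b b0 E] := qchar1P F_odd q1; rewrite E.
rewrite (eq_bigr (fun _ => 1 + s * qchar b)) => [|a]; last first.
  by rewrite eqf_sqr => /orP[] /eqP-> //; rewrite (qcharN F_odd qcharN1_sqrt).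
rewrite sumr_const.
have -> : #|(fun a : F => a ^+ 2 == b ^+ 2)| = 2%N.
  by apply/eqP; rewrite -eqz_nat (card_sqr_roots F_odd) (qchar_sqr F_odd).
rewrite -exprM mulnC -half_4n -(qchar_expr F_odd).
have /orP[/eqP->|/eqP->] : (s == 1) || (s == -1) by rewrite -sqrf_eq1 s2.
  by case: (qchar_cases b0) => ->; rewrite ?eqxx //= (negbTE (neq_N1 F_odd)).
case: (qchar_cases b0) => ->; rewrite ?eqxx //=.
by rewrite eq_sym (negbTE (neq_N1 F_odd)).
Qed.

(** Sort the points by t = e a^2, so that 1 - t = e w^2. By [sum_fiber], each [t] other than 0 and 1
    contributes 4 * 4 if both [t] and [1 - t] lie in the coset, while t = 0 and t = 1 contribute 1 *
    4 each if 1 does. *)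
Lemma conic_classes :
  conic (fun a w => (1 + s * qchar a) * (1 + s * qchar w)) =
    16 * \sum_t ((t ^+ n == k) && ((1 - t) ^+ n == k))%:Z + 8 * (1 == k)%:Z.
Proof.
have n_gt0 : (0 < n)%N by have := card_finField_gt1 F; rewrite card_4n; case: n.
have k0 : k != 0.
  rewrite mulf_neq0 ?expf_neq0 //; apply/eqP => sF.
  have := congr1 (fun z : int => z%:~R : F) s2.
  by rewrite rmorphXn /= sF expr0n /= => /eqP; rewrite eq_sym oner_eq0.
pose u a : int := 1 + s * qchar a.
pose v t : int := \sum_(a | e * a ^+ 2 == t) u a.
transitivity (\sum_t v t * v (1 - t)).
  rewrite /conic (partition_big (fun a => e * a ^+ 2) predT) //=.
  apply: eq_bigr => t _; rewrite /v mulr_suml; apply: eq_bigr => a /eqP ta.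
  rewrite mulr_sumr ta; apply: eq_bigl => w.
  by rewrite -[RHS](inj_eq (addrI t)) [t + (1 - t)]addrC subrK.
have vE t : v t = if t == 0 then 1 else 4 * (t ^+ n == k)%:Z by exact: sum_fiber.
have z0 : (0 ^+ n == k) = false by rewrite expr0n eqn0Ngt n_gt0 eq_sym (negbTE k0).
rewrite (bigD1 0) //= (bigD1 1) ?oner_neq0 //= [in RHS](bigD1 0) //= [in RHS](bigD1 1) ?oner_neq0 //=.
rewrite !subr0 subrr z0 andbF /= !add0r !vE eqxx oner_eq0 expr1n.
rewrite mulr_sumr [RHS]addrC addrA; congr (_ + _); first by case: (1 == k).
apply: eq_bigr => t /andP[t0 t1]; rewrite !vE (negbTE t0) subr_eq0 [1 == t]eq_sym (negbTE t1).
by case: (_ == k); case: (_ == k).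
Qed.

(** Two evaluations of the same weighted conic sum are equated; [sum_reflection] reduces the parity
    of the count to whether 1/2 lies in the coset. *)
Lemma jacobsthal_count : exists T : int,
  16 * (2 * T + ((2^-1 : F) ^+ n == k)%:Z) + 8 * (1 == k)%:Z =
  #|F|%:Z - 1 + 2 * s * (qchar e * jacobsthal e) + qchar i * (qchar e * jacobsthal (1 : F) - 2).
Proof.
rewrite -(conic_weighted s2) conic_classes.
have [t|T ->] := sum_reflection (f := fun t => ((t ^+ n == k) && ((1 - t) ^+ n == k))%:Z).
  by rewrite subKr andbC.
exists T; congr (16 * (2 * T + _) + _).
have -> : 1 - 2^-1 = 2^-1 :> F by field; exact: two_neq0.
by rewrite andbb.
Qed.

End Conic.

(** * Binomial sums *)

Section BinomialSums.
Variable R : comNzRingType.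
Implicit Types (z a b : R).

Lemma sum_ord_trunc (n p : nat) (f : nat -> R) : (n <= p)%N ->
  (forall k, (n <= k)%N -> f k = 0) -> \sum_(k < p) f k = \sum_(k < n) f k.
Proof.
move=> np f0; rewrite -!(big_mkord predT) (big_cat_nat_idem _ _ np) //=; last exact: addr0.
by rewrite [X in _ + X]big_nat_cond [X in _ + X]big1 ?addr0 // => k /andP[/andP[/f0]].
Qed.

Lemma sum_ord_even (n : nat) (f : nat -> R) : (forall k, odd k -> f k = 0) ->
  \sum_(k < n.*2) f k = \sum_(j < n) f j.*2.
Proof.
move=> f0; elim: n => [|n IH]; first by rewrite !big_ord0.
by rewrite doubleS !big_ord_recr /= IH (f0 n.*2.+1) ?addr0 //= odd_double.
Qed.

Lemma natr_ffactSr (n k : nat) :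
  (n ^_ k.+1)%:R = (n ^_ k)%:R * (n%:R - k%:R) :> R.
Proof.
have [kn|nk] := leqP k n; first by rewrite ffactnSr natrM natrB.
by rewrite !ffact_small ?mul0r // ltnW.
Qed.

Lemma coef_expr1DX (n k : nat) : ((1 + 'X) ^+ n)`_k = 'C(n, k)%:R :> R.
Proof.
rewrite exprDn coef_sum.
under eq_bigr do rewrite expr1n mul1r coefMn coefXn.
have [kn|nk] := ltnP k n.+1.
  rewrite (bigD1 (Ordinal kn)) //= eqxx big1 ?addr0 // => i iN.
  by case: eqP => [E|]; rewrite ?mul0rn //; case/eqP: iN; apply: val_inj.
rewrite big1 => [|i _]; first by rewrite bin_small.
by rewrite gtn_eqF ?mul0rn // (leq_trans (ltn_ord i)).
Qed.

(* Compare the coefficients of ['X^N] in [(1 + X)^N (1 + z X)^N], expanding the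
   second factor either directly or as [(z (1 + X) + (1 - z))^N]. *)
Lemma sum_bin_sqr (N : nat) z :
  \sum_(k < N.+1) 'C(N, k)%:R ^+ 2 * z ^+ k =
  \sum_(k < N.+1) 'C(N, k)%:R * 'C(N + k, k)%:R * z ^+ k * (1 - z) ^+ (N - k).
Proof.
transitivity (((1 + 'X) ^+ N * (1 + z%:P * 'X) ^+ N)`_N).
  rewrite [(1 + z%:P * 'X) ^+ N]exprDn mulr_sumr coef_sum; apply: eq_bigr => k _.
  rewrite expr1n mul1r exprMn -mulrnAl mulrA coefMXn ltnNge leq_ord /=.
  rewrite -(polyC_exp k z) mulrnAr coefMn coefMC coef_expr1DX bin_sub ?leq_ord //.
  by rewrite -mulr_natl; ring.
have -> : 1 + z%:P * 'X = (1 - z)%:P + z%:P * (1 + 'X) by rewrite polyCB; ring.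
rewrite [(_ + z%:P * _) ^+ N]exprDn mulr_sumr coef_sum; apply: eq_bigr => k _.
have -> : (1 + 'X) ^+ N * ((1 - z)%:P ^+ (N - k) * (z%:P * (1 + 'X)) ^+ k *+ 'C(N, k)) =
   (1 + 'X) ^+ (N + k) * ((1 - z) ^+ (N - k) * z ^+ k)%:P *+ 'C(N, k).
  by rewrite exprMn exprD polyCM !polyC_exp -mulrnAr; ring.
rewrite coefMn coefMC coef_expr1DX -(bin_sub (leq_addr k N)) addKn.
by rewrite -mulr_natl; ring.
Qed.

Lemma coef_sqrXDc (i : nat) b :
  (('X ^+ 2 + b%:P) ^+ i)`_i = if odd i then 0 else 'C(i, i./2)%:R * b ^+ i./2.
Proof.
rewrite exprDn coef_sum.
rewrite (eq_bigr (fun k : 'I_i.+1 => if i == k.*2 then 'C(i, k)%:R * b ^+ k else 0)); last first.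
  move=> k _; rewrite -exprM -polyC_exp coefMn coefMC coefXn.
  have -> : (i == 2 * (i - k))%N = (i == k.*2) by have := ltn_ord k; lia.
  by case: eqP => _ /=; [rewrite mul1r mulr_natl | rewrite mul0r mul0rn].
case: ifP => oi.
  rewrite big1 // => k _.
  by have -> : (i == k.*2) = false by move: (nat_of_ord k) => j; lia.
have hi : (i./2 < i.+1)%N by lia.
rewrite (bigD1 (Ordinal hi)) //= big1 ?addr0 => [|k kN].
  by have -> : i == (i./2).*2 by lia.
have ki : (k != i./2 :> nat) by apply: contra_neq kN => E; exact: val_inj.
by have -> : (i == k.*2) = false by move: (nat_of_ord k) ki => j; lia.
Qed.

Lemma coef_trinomial (m : nat) a b :
  (('X ^+ 2 + a *: 'X + b%:P) ^+ m)`_m =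
  \sum_(j < m.+1) 'C(m, j.*2)%:R * 'C(j.*2, j)%:R * b ^+ j * a ^+ (m - j.*2).
Proof.
have -> : 'X ^+ 2 + a *: 'X + b%:P = a *: 'X + ('X ^+ 2 + b%:P) by ring.
rewrite exprDn coef_sum.
pose f i := if odd i then 0 else 'C(m, i)%:R * ('C(i, i./2)%:R * b ^+ i./2) * a ^+ (m - i).
have fE (i : 'I_m.+1) : ((a *: 'X) ^+ (m - i) * ('X ^+ 2 + b%:P) ^+ i *+ 'C(m, i))`_m = f i.
  rewrite exprZn coefMn -scalerAl coefZ coefXnM.
  have im : (i <= m)%N := leq_ord i.
  rewrite ltnNge leq_subr /= (subKn im) coef_sqrXDc /f.
  by case: ifP => _; rewrite ?mulr0 ?mul0rn // -mulr_natl; ring.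
rewrite (eq_bigr _ (fun i _ => fE i)).
(* The range is doubled so that [sum_ord_even] leaves exactly [j < m.+1]; the added terms have a
   vanishing binomial. *)
rewrite -(@sum_ord_trunc m.+1 (m.+1).*2 f) ?sum_ord_even //.
- by apply: eq_bigr => j _; rewrite /f odd_double doubleK; ring.
- by move=> k ok; rewrite /f ok.
- by rewrite -addnn leq_addl.
- by move=> k mk; rewrite /f bin_small // !mul0r; case: ifP.
Qed.

End BinomialSums.

(** * Power sums of cubics, and the binomial sums in terms of [jacobsthal] *)

Section CubicSums.
Variable F : finFieldType.
Hypothesis F_odd : odd #|F|.
Implicit Types (a b c x : F).

Let m := #|F|./2.

Lemma natr_half : m%:R = - (1 / 2) :> F.
Proof.
have n2 := two_neq0 F_odd.
have := card_finField_natr F; rewrite (card_half F_odd) -addn1 natrD natrM -/m => E.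
by apply: (mulfI n2); rewrite mulrN mulrCA divff // mulr1; apply/eqP; rewrite -addr_eq0 E.
Qed.

(** The polynomial has degree at most 3 m, below 2 (q - 1) = 4 m where q = 2 m + 1 is the cardinal,
    so only its coefficient of degree 2 m counts. After removing the factor ['X ^+ m], this is a
    central trinomial coefficient. *)
Lemma sum_expr_cubic a b :
  \sum_x (x * (x ^+ 2 + a * x + b)) ^+ m =
  - \sum_(j < m.+1) 'C(m, j.*2)%:R * 'C(j.*2, j)%:R * b ^+ j * a ^+ (m - j.*2).
Proof.
have m_gt0 := half_gt0 F_odd; have F2m := card_half F_odd; rewrite -/m in m_gt0 F2m.
pose Q : {poly F} := 'X ^+ 2 + a *: 'X + b%:P.
have E x : (x * (x ^+ 2 + a * x + b)) ^+ m = (('X * Q) ^+ m).[x].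
  by rewrite /Q !hornerE.
rewrite (eq_bigr _ (fun x _ => E x)) sum_horner_finField; last first.
  have sQ : (size Q <= 3)%N.
    rewrite /Q (leq_trans (size_polyD _ _)) // geq_max size_polyC.
    rewrite (leq_trans (size_polyD _ _)) ?(leq_trans (leq_b1 _)) //.
    by rewrite geq_max size_polyXn (leq_trans (size_scale_leq _ _)) // size_polyX.
  rewrite (leq_trans (size_poly_exp_leq _ _)) //.
  have : (size ('X * Q)%R <= 4)%N.
    by rewrite (leq_trans (size_polyMleq _ _)) // size_polyX addSn /= add1n ltnS.
  by rewrite F2m /=; case: (size _) => [|s]; nia.
congr (- _); rewrite F2m /= exprMn mulrC coefMXn ltnNge.
have -> : (m <= 2 * m)%N by lia.
have -> : (2 * m - m = m)%N by lia.
exact: coef_trinomial.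
Qed.

Lemma jacobsthal_expr c : (jacobsthal c)%:~R = \sum_x (x * (x ^+ 2 + 0 * x - c)) ^+ m.
Proof.
rewrite /jacobsthal rmorph_sum /=; apply: eq_bigr => x _.
by rewrite rmorphM /= !(qchar_expr F_odd) mul0r addr0 exprMn.
Qed.

(** With linear coefficient 0 in [sum_expr_cubic], the factor 0^(m - 2 j) kills every term but j =
    n, so that [c] enters only through [(- c) ^+ n]. *)
Lemma jacobsthal_modulo (n : nat) c : #|F| = (4 * n).+1 ->
  (jacobsthal c)%:~R = (jacobsthal (1 : F))%:~R * c ^+ n.
Proof.
move=> F4n; have mn : m = n.*2 by rewrite /m F4n; lia.
have E d : (jacobsthal d)%:~R = - 'C(n.*2, n)%:R * (- d) ^+ n :> F.
  rewrite jacobsthal_expr sum_expr_cubic mn.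
  have nlt : (n < n.*2.+1)%N by lia.
  rewrite (bigD1 (Ordinal nlt)) //= big1 ?addr0 => [|j jn].
    by rewrite binn subnn expr0 mul1r mulr1 mulNr.
  have [jlt|jgt|je] := ltngtP j n.
  - by rewrite expr0n subn_eq0 leq_double leqNgt jlt mulr0.
  - by rewrite bin_small ?ltn_double // !mul0r.
  by case/eqP: jn; apply: val_inj.
by rewrite !E -mulrA -exprMn mulN1r.
Qed.

(* The curve y^2 = x (x + 1) (x + 2) is a translate of y^2 = x^3 - x. *)
Lemma jacobsthal1_cubic :
  (jacobsthal (1 : F))%:~R = \sum_(x : F) (x * (x ^+ 2 + 3 * x + 2)) ^+ m.
Proof.
rewrite jacobsthal_expr (reindex_inj (addIr 1)) /=; apply: eq_bigr => x _.
by congr (_ ^+ _); ring.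
Qed.

(** Here -1 is a nonresidue, so [x -> - x] negates the sum. *)
Lemma jacobsthal_3mod4 : odd m -> jacobsthal (1 : F) = 0.
Proof.
move=> om; have qN : qchar (-1 : F) = -1.
  by rewrite /qchar oppr_eq0 oner_eq0 -/m -signr_odd om (negbTE (neq_N1 F_odd)).
suff /eqP : jacobsthal (1 : F) = - jacobsthal (1 : F).
  by rewrite -addr_eq0 -mulr2n mulrn_eq0 => /eqP.
rewrite {1}/jacobsthal (reindex_inj oppr_inj) -sumrN; apply: eq_bigr => x _ /=.
by rewrite sqrrN -mulN1r (qcharM F_odd) qN mulN1r mulNr.
Qed.

Variables (p N : nat).
Hypothesis p_prime : prime p.
Hypothesis card_F : #|F| = p.
Hypothesis N_lt : (N < p)%N.
Hypothesis N_quarter : (4 * N + 1)%:R = 0 :> F.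

Let pcharF : p \in [pchar F].
Proof. by apply: (@card_finPcharP F p 1); rewrite ?expn1. Qed.

Lemma natr_fact_neq0 k : (k < p)%N -> k`!%:R != 0 :> F.
Proof.
elim: k => [|k IH] kp; first by rewrite oner_neq0.
rewrite factS natrM mulf_neq0 ?IH ?(ltnW kp) //.
by rewrite -(dvdn_pcharf pcharF) gtnNdvd.
Qed.

Lemma natr_quarter : N%:R = - (1 / 4) :> F.
Proof.
have n4 : 4 != 0 :> F by rewrite (natrM F 2 2) mulf_neq0 // two_neq0.
apply: (mulfI n4); rewrite mulrN mulrCA divff // mulr1; apply/eqP.
by rewrite -addr_eq0; have := N_quarter; rewrite natrD natrM => ->.
Qed.

(* With N = -1/4 and m = -1/2, both sides times k!^2 are the product of the
   (4 j + 1) (4 j + 3) / 4 for j < k. *)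
Lemma bin_quarter k : (k < p)%N ->
  'C(N, k)%:R * 'C(N + k, k)%:R * (-4) ^+ k = 'C(m, k.*2)%:R * 'C(k.*2, k)%:R :> F.
Proof.
move=> kp; have k0 := natr_fact_neq0 kp.
have n2 := two_neq0 F_odd; have n4 : 4 != 0 :> F by rewrite (natrM F 2 2) mulf_neq0.
apply: (mulIf k0); apply: (mulIf k0).
have -> : 'C(N, k)%:R * 'C(N + k, k)%:R * (-4) ^+ k * k`!%:R * k`!%:R =
   (N ^_ k)%:R * ((N + k) ^_ k)%:R * (-4) ^+ k :> F.
  by rewrite -!bin_ffact !natrM; ring.
have -> : 'C(m, k.*2)%:R * 'C(k.*2, k)%:R * k`!%:R * k`!%:R = (m ^_ k.*2)%:R :> F.
  have kk : (k <= k.*2)%N by lia.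
  have k2 : (k.*2 - k)%N = k by lia.
  by rewrite -bin_ffact -(bin_fact kk) k2 -!natrM !mulnA.
elim: k {kp k0} => [|k IH]; first by rewrite !ffactn0 !mulr1.
rewrite doubleS (natr_ffactSr F N) !(natr_ffactSr F m) -IH addnS ffactSS natrM exprS.
have -> : (N + k).+1%:R = N%:R + k%:R + 1 :> F by rewrite -addn1 !natrD.
have -> : k.*2.+1%:R = 2 * k%:R + 1 :> F by rewrite -addn1 natrD -mul2n natrM.
rewrite -[k.*2]mul2n natrM natr_half natr_quarter; by field; rewrite n2 n4.
Qed.

(** At z = -8 one has 1 - z = 9 and z = (-4) * 2, so [bin_quarter] makes both sides multiples of one
    sum in powers of 2/9; this ratio is b / a^2 for the cubic with a = 3 and b = 2. *)
Lemma sum_bin_sqr_quarter : 3 != 0 :> F ->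
  3 ^+ m * \sum_(k < p) 'C(N, k)%:R ^+ 2 * (-8) ^+ k =
  - (9 ^+ N * (jacobsthal (1 : F))%:~R) :> F.
Proof.
move=> n3; have n9 : 9 != 0 :> F by rewrite (natrM F 3 3) mulf_neq0.
have m_lt : (m < p)%N by rewrite -card_F /m (card_half F_odd); lia.
rewrite jacobsthal1_cubic sum_expr_cubic mulrN opprK.
rewrite (sum_ord_trunc (f := fun k => 'C(N, k)%:R ^+ 2 * (-8) ^+ k) N_lt); last first.
  by move=> k Nk; rewrite bin_small // expr0n mul0r.
rewrite sum_bin_sqr.
have -> : 1 - -8 = 9 :> F by ring.
have E1 (k : 'I_N.+1) : 'C(N, k)%:R * 'C(N + k, k)%:R * (-8) ^+ k * 9 ^+ (N - k) =
    9 ^+ N * ('C(m, k.*2)%:R * 'C(k.*2, k)%:R * (2 / 9) ^+ k) :> F.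
  have kN : (k <= N)%N := leq_ord k.
  rewrite -bin_quarter ?(leq_ltn_trans kN) // expr_div_n.
  have -> : -8 = (-4) * 2 :> F by ring.
  have -> : 9 ^+ N = 9 ^+ (N - k) * 9 ^+ k :> F by rewrite -exprD subnK.
  by rewrite exprMn; field; exact: expf_neq0.
have E2 (k : 'I_m.+1) : 'C(m, k.*2)%:R * 'C(k.*2, k)%:R * 2 ^+ k * 3 ^+ (m - k.*2) =
    3 ^+ m * ('C(m, k.*2)%:R * 'C(k.*2, k)%:R * (2 / 9) ^+ k) :> F.
  have [km|mk] := leqP k.*2 m; last by rewrite bin_small // !mul0r mulr0.
  have -> : 9 = 3 ^+ 2 :> F by ring.
  have -> : 3 ^+ m = 3 ^+ (m - k.*2) * 3 ^+ k.*2 :> F by rewrite -exprD subnK.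
  by rewrite expr_div_n -exprM mul2n; field; exact: expf_neq0.
rewrite (eq_bigr _ (fun k _ => E1 k)) (eq_bigr _ (fun k _ => E2 k)) -!mulr_sumr.
rewrite mulrCA; congr (_ * (_ * _)).
(* The two sums run up to [N] and up to [m]. The common summand vanishes beyond either bound, beyond
   [N] by [bin_quarter] read backwards, so both equal the sum over [k < p]. *)
pose f k : F := 'C(m, k.*2)%:R * 'C(k.*2, k)%:R * (2 / 9) ^+ k.
rewrite -(sum_ord_trunc (f := f) N_lt); last first.
  move=> k Nk; rewrite /f; have [kp|pk] := ltnP k p.
    by rewrite -bin_quarter // bin_small // !mul0r.
  rewrite bin_small ?mul0r //; lia.
rewrite -(sum_ord_trunc (f := f) m_lt) // => k mk; rewrite /f bin_small ?mul0r //; lia.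
Qed.

Lemma sum_bin_sqr_rev (z : F) : z != 0 ->
  z ^+ N * \sum_(k < p) 'C(N, k)%:R ^+ 2 * (z^-1) ^+ k = \sum_(k < p) 'C(N, k)%:R ^+ 2 * z ^+ k.
Proof.
move=> z0.
rewrite !(sum_ord_trunc (f := fun k => 'C(N, k)%:R ^+ 2 * _ ^+ k) N_lt);
  try by move=> k Nk; rewrite bin_small // expr0n mul0r.
rewrite (reindex_inj rev_ord_inj) mulr_sumr; apply: eq_bigr => k _ /=.
have kN : (k <= N)%N := leq_ord k.
rewrite subSS bin_sub // mulrCA; congr (_ * _).
have -> : z ^+ N = z ^+ (N - k) * z ^+ k by rewrite -exprD subnK.
by rewrite exprVn mulrAC divff ?mul1r ?expf_neq0.
Qed.

End CubicSums.

(** * Reduction of rational numbers *)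

Section Reduction.
Variable F : fieldType.

(** This is the graph of the reduction map from rationals with denominator invertible in [F]. The
    fraction need not be in lowest terms, which makes closure under the operations immediate. *)
Definition reduces_to (a : rat) (r : F) : Prop :=
  exists n d : int, [/\ d%:~R != 0 :> F, a * d%:~R = n%:~R & r * d%:~R = n%:~R].

Lemma intr_neq0_rat (d : int) : d%:~R != 0 :> F -> d%:~R != 0 :> rat.
Proof. by rewrite intr_eq0; apply: contraNneq => ->. Qed.

Lemma reduces_int (n : int) : reduces_to n%:~R n%:~R.
Proof. by exists n, 1; rewrite !mulr1 oner_eq0. Qed.

Lemma reduces_nat (n : nat) : reduces_to n%:R n%:R.
Proof. exact: (reduces_int n). Qed.

Lemma reducesD a b r s : reduces_to a r -> reduces_to b s -> reduces_to (a + b) (r + s).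
Proof.
move=> [n [d [d0 an rn]]] [n' [d' [d0' bn sn]]]; exists (n * d' + n' * d), (d * d').
by rewrite !rmorphD !rmorphM /= mulf_neq0 // -an -bn -rn -sn; split=> //; ring.
Qed.

Lemma reducesM a b r s : reduces_to a r -> reduces_to b s -> reduces_to (a * b) (r * s).
Proof.
move=> [n [d [d0 an rn]]] [n' [d' [d0' bn sn]]]; exists (n * n'), (d * d').
by rewrite !rmorphM /= mulf_neq0 // -an -bn -rn -sn; split=> //; ring.
Qed.

Lemma reducesN a r : reduces_to a r -> reduces_to (- a) (- r).
Proof.
by move=> ar; rewrite -mulN1r -[- r]mulN1r; apply: reducesM (reduces_int (-1)) ar.
Qed.

Lemma reducesV a r : r != 0 -> reduces_to a r -> reduces_to a^-1 r^-1.
Proof.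
move=> r0 [n [d [d0 an rn]]]; exists d, n.
have n0 : n%:~R != 0 :> F by rewrite -rn mulf_neq0.
have a0 : a != 0 by apply: contraNneq (intr_neq0_rat n0) => a0; rewrite -an a0 mul0r.
by split; rewrite // -?an -?rn mulKf.
Qed.

Lemma reducesX a r k : reduces_to a r -> reduces_to (a ^+ k) (r ^+ k).
Proof.
move=> ar; elim: k => [|k IH]; first exact: (reduces_int 1).
by rewrite !exprS; apply: reducesM.
Qed.

Lemma reduces_sum (n : nat) (f : nat -> rat) (g : nat -> F) :
  (forall k, (k < n)%N -> reduces_to (f k) (g k)) ->
  reduces_to (\sum_(0 <= k < n) f k) (\sum_(k < n) g k).
Proof.
rewrite big_mkord; elim: n => [|n IH] fg; first by rewrite !big_ord0; exact: (reduces_int 0).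
by rewrite !big_ord_recr /=; apply: reducesD; [apply: IH => k kn|]; apply: fg; rewrite // ltnW.
Qed.

Lemma reduces_binomial a (N k : nat) : k`!%:R != 0 :> F -> reduces_to a N%:R ->
  reduces_to (rat_binomial a k) 'C(N, k)%:R.
Proof.
move=> k0 aN.
have -> : 'C(N, k)%:R = (N ^_ k)%:R / k`!%:R :> F by rewrite -bin_ffact natrM mulfK.
apply: reducesM (reducesV k0 (reduces_nat _)).
elim: k {k0} => [|k IH]; first by rewrite big_ord0 ffactn0; exact: (reduces_nat 1).
rewrite big_ord_recr natr_ffactSr /=.
by apply: reducesM => //; apply: reducesD => //; apply: reducesN; apply: reduces_nat.
Qed.

End Reduction.

Lemma intr_Fp_eq0 (p : nat) (z : int) : prime p -> (z%:~R == 0 :> 'F_p) = (p%:Z %| z)%Z.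
Proof.
move=> p_prime; rewrite dvdzE absz_nat (dvdn_pcharf (pchar_Fp p_prime)).
case: (intP z) => [|n|n] //=; by rewrite mulrNz oppr_eq0.
Qed.

(** Any witness [d] is a multiple of the reduced denominator, so [p] not dividing [d] gives
    integrality. The difference reduces to 0, so [p] divides its witness numerator, and then the
    reduced one by Gauss. *)
Lemma reduces_eqmod (p : nat) (a b : rat) (r : 'F_p) : prime p ->
  reduces_to a r -> reduces_to b r -> rat_eqmod p a b.
Proof.
move=> p_prime.
have integral c (s : 'F_p) : reduces_to c s -> integral_at p c.
  move=> [n [d [d0 cn _]]]; rewrite /integral_at.
  have E : numq c * d = n * denq c.
    apply/eqP; rewrite -(eqr_int rat) !rmorphM /= -cn [c * _ * _]mulrAC; apply/eqP.
    by rewrite -{2}[c]divq_num_den divfK // intr_eq0 denq_eq0.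
  have dd : (denq c %| d)%Z.
    rewrite -(@Gauss_dvdzr (denq c) (numq c)); last by rewrite coprimez_sym coprimezE coprime_num_den.
    by rewrite E dvdz_mull.
  rewrite coprimez_sym coprimezE absz_nat prime_coprime //.
  apply: contra d0 => pd; rewrite intr_Fp_eq0 //; apply: dvdz_trans dd; exact: pd.
move=> ar br; split; [exact: integral ar|exact: integral br|].
have [n [d [d0 cn rn]]] := reducesD ar (reducesN br).
move: rn; rewrite subrr mul0r => /esym/eqP; rewrite intr_Fp_eq0 // => pn.
have E : numq (a - b) * d = n * denq (a - b).
  apply/eqP; rewrite -(eqr_int rat) !rmorphM /= -cn [_ * d%:~R * _]mulrAC; apply/eqP.
  by rewrite -{2}[a - b]divq_num_den divfK // intr_eq0 denq_eq0.
rewrite -(@Gauss_dvdzl p%:Z _ d); first by rewrite E dvdz_mulr.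
by rewrite coprimezE absz_nat prime_coprime // -[p in (p %| _)%N]absz_nat -dvdzE -intr_Fp_eq0.
Qed.

(** * Representations as sums of two squares *)

Lemma odd_intP (a : int) : ~~ (2 %| a)%Z -> exists b, a = 2 * b + 1.
Proof. by move=> oa; exists (a %/ 2)%Z; lia. Qed.

(** Since [p] divides (a y - b x) (a y + b x), it divides a c - b x with c = y or c = -y. The
    identity (a x + b c)^2 + (a c - b x)^2 = p^2 then leaves two cases: a c = b x, which gives the
    claim, or a x + b c = 0, which gives p = a^2 + x^2, even for odd [a] and [x]. *)
Lemma two_squares_unique (p : nat) (a b x y : int) : prime p -> odd p ->
  p%:Z = a ^+ 2 + b ^+ 2 -> p%:Z = x ^+ 2 + y ^+ 2 ->
  ~~ (2 %| a)%Z -> ~~ (2 %| x)%Z -> a ^+ 2 = x ^+ 2.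
Proof.
move=> p_prime p_odd pab pxy oa ox; have p0 := prime_gt0 p_prime.
have main c : c ^+ 2 = y ^+ 2 -> (p%:Z %| a * c - b * x)%Z -> a ^+ 2 = x ^+ 2.
  move=> cy /dvdzP[t tE]; rewrite -cy in pxy.
  have E1 : (a * x + b * c) ^+ 2 = p%:Z ^+ 2 * (1 - t ^+ 2).
    have -> : (a * x + b * c) ^+ 2 = (a ^+ 2 + b ^+ 2) * (x ^+ 2 + c ^+ 2) - (a * c - b * x) ^+ 2 by ring.
    by rewrite -pab -pxy tE; ring.
  have [t0|t0] := eqVneq t 0.
    have : p%:Z * (a ^+ 2 - x ^+ 2) = (a * c - b * x) * (a * c + b * x).
      by rewrite mulrBr {1}pxy pab; ring.
    by rewrite tE t0 !mul0r => /eqP; rewrite mulf_eq0 subr_eq0 => /orP[|/eqP //]; lia.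
  have E2 : a * x + b * c = 0.
    apply/eqP; rewrite -sqrf_eq0 eq_le sqr_ge0 andbT E1 mulr_ge0_le0 ?sqr_ge0 // subr_le0.
    by rewrite -gtz0_ge1 lt_def sqrf_eq0 t0 sqr_ge0.
  have E3 : p%:Z * (p%:Z - (a ^+ 2 + x ^+ 2)) = 0.
    have -> : p%:Z * (p%:Z - (a ^+ 2 + x ^+ 2)) = (p%:Z - a ^+ 2) * (p%:Z - x ^+ 2) - a ^+ 2 * x ^+ 2 by ring.
    have -> : p%:Z - a ^+ 2 = b ^+ 2 by rewrite pab; ring.
    have -> : p%:Z - x ^+ 2 = c ^+ 2 by rewrite pxy; ring.
    have -> : b ^+ 2 * c ^+ 2 - a ^+ 2 * x ^+ 2 = (b * c - a * x) * (a * x + b * c) by ring.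
    by rewrite E2 mulr0.
  move/eqP: E3; rewrite mulf_eq0 => /orP[|/eqP E3]; first by lia.
  have [a' aE] := odd_intP oa; have [x' xE] := odd_intP ox.
  have E4 : p%:Z = 2 * (2 * a' ^+ 2 + 2 * a' + 2 * x' ^+ 2 + 2 * x' + 1).
    by move/eqP: E3; rewrite subr_eq0 aE xE => /eqP ->; ring.
  move: E4 p_odd; set k := (_ + 1); clearbody k; clear; lia.
have : (p%:Z %| (a * y - b * x) * (a * y + b * x))%Z.
  have -> : (a * y - b * x) * (a * y + b * x) = p%:Z * (a ^+ 2 - x ^+ 2).
    by rewrite mulrBr {1}pxy pab; ring.
  exact: dvdz_mulr.
rewrite dvdzE abszM absz_nat Euclid_dvdM // => /orP[h|h].
  by apply: (main y); rewrite // dvdzE absz_nat.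
apply: (main (- y)); first by rewrite sqrrN.
by rewrite mulrN -opprD dvdzE abszN absz_nat.
Qed.

(** The exponents in the theorem are quotients of integers of either sign. *)
Lemma exprN1_int (R : unitRingType) (z : int) :
  (-1) ^ z = if (2 %| z)%Z then 1 else -1 :> R.
Proof.
have Nz (k : nat) : (-1) ^+ k = if (2 %| k%:Z)%Z then 1 else -1 :> R.
  have -> : (2 %| k%:Z)%Z = ~~ odd k by lia.
  by rewrite -signr_odd; case: (odd k).
case: z => k; first exact: Nz.
rewrite NegzE -exprnN -exprVn invrN1 Nz.
by have -> : (2 %| k.+1%:Z)%Z = (2 %| - k.+1%:Z)%Z by lia.
Qed.

Lemma half_sum_sqr (J G N : int) (a : int) :
  J = 2 * a -> J ^+ 2 + G ^+ 2 = 4 * N -> exists b, G = 2 * b /\ N = a ^+ 2 + b ^+ 2.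
Proof.
move=> Ja JG.
have [b Gb] : exists b : int, G = 2 * b.
  suff : ~~ ~~ (2 %| G)%Z by exists (G %/ 2)%Z; clear JG; lia.
  apply/negP => /odd_intP[g Gg]; move: JG; rewrite Ja Gg.
  have -> : (2 * a) ^+ 2 + (2 * g + 1) ^+ 2 = 4 * (a ^+ 2 + g ^+ 2 + g) + 1 by ring.
  by set u := a ^+ 2 + _ + _; clearbody u; clear; lia.
exists b; split=> //; apply: (@mulfI _ 4) => //; rewrite -JG Ja Gb; ring.
Qed.

Lemma dvd2_mul_succ (k : int) : (2 %| k * (k + 1))%Z.
Proof.
have [h|/odd_intP[z ->]] := boolP (2 %| k)%Z; first by rewrite dvdz_mulr.
by apply/dvdz_mull/dvdzP; exists (z + 1); ring.
Qed.

(** Write J = 2 a. The count forces a = -1 modulo 4, so among the two roots of a^2 = x^2 it is -x;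
    putting this back into the count leaves the parity of y / 4. *)
Lemma jacobsthal_arith_1mod8 (p : nat) (J G T x y : int) (c : bool) :
  prime p -> (p = 1 %[mod 8])%N -> J ^+ 2 + G ^+ 2 = 4 * p%:Z ->
  16 * (2 * T + c%:Z) + 8 = p%:Z - 3 + 3 * J ->
  p%:Z = x ^+ 2 + y ^+ 2 -> (4 %| x - 1)%Z ->
  J = - (2 * x) /\ (2 %| (y %/ 4)%Z)%Z = c.
Proof.
move=> p_prime p8 JG JT pxy x4.
have [r pr] : exists r : int, p%:Z = 8 * r + 1 by exists (p %/ 8)%N; lia.
have [k xk] : exists k : int, x = 4 * k + 1 by exists ((x - 1) %/ 4)%Z; lia.
have [a Ja] : exists a : int, J = 2 * a.
  by clear JG pxy; exists (J %/ 2)%Z; lia.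
have [a' aa'] : exists a', a = 4 * a' - 1.
  by clear JG pxy; exists ((a + 1) %/ 4)%Z; lia.
have [b [Gb pab]] := half_sum_sqr Ja JG.
have ax : a ^+ 2 = x ^+ 2.
  apply: (two_squares_unique p_prime _ pab pxy); clear JG pxy pab; lia.
have {}ax : a = - x.
  by move/eqP: ax; rewrite eqf_sqr => /orP[/eqP|/eqP //]; clear JG pxy pab; lia.
split; first by rewrite Ja ax; ring.
have y2 : y ^+ 2 = 8 * r - 16 * k ^+ 2 - 8 * k.
  by apply: (addrI (x ^+ 2)); rewrite -pxy pr xk; ring.
have [y1 yy1] : exists y1 : int, y = 4 * y1.
  have : (4 %| y)%Z || (2 %| y)%Z && ~~ (4 %| y)%Z || ~~ (2 %| y)%Z by clear; lia.
  case/orP => [/orP[h|/andP[h1 h2]]|/odd_intP[z yz]].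
  - by exists (y %/ 4)%Z; clear -h; lia.
  - have [z yz] : exists z : int, y = 4 * z + 2 by exists (y %/ 4)%Z; clear -h1 h2; lia.
    move: y2; rewrite yz.
    have -> : (4 * z + 2) ^+ 2 = 16 * (z ^+ 2 + z) + 4 by ring.
    by set u := _ + z; set v := k ^+ 2; clearbody u v; clear; lia.
  - move: y2; rewrite yz.
    have -> : (2 * z + 1) ^+ 2 = 4 * (z ^+ 2 + z) + 1 by ring.
    by set u := _ + z; set v := k ^+ 2; clearbody u v; clear; lia.
(* Here y = 4 y1 and x = 4 k + 1. As k (k - 1) is even, [c] is true exactly when y1 is even. *)
have E : 2 * T + c%:Z = k * (k - 1) - 1 + y1 ^+ 2.
  have y2' := y2; rewrite yy1 exprMn in y2'.
  have K : k * (k - 1) = k ^+ 2 - k by ring.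
  rewrite K; move: JT y2'; rewrite Ja ax xk pr.
  by set u := y1 ^+ 2; set v := k ^+ 2; clearbody u v; clear; lia.
have kk := dvd2_mul_succ (k - 1); rewrite subrK mulrC in kk.
have yk : (2 %| y1 ^+ 2)%Z = (2 %| y1)%Z.
  by rewrite !dvdzE abszX Euclid_dvdX // andbT.
have -> : (y %/ 4)%Z = y1 by rewrite yy1 mulKz.
rewrite -yk; move: E kk; set u := y1 ^+ 2; set v := k * _; clearbody u v.
by case: (c) => /=; clear; lia.
Qed.

(** Write J = 2 a and G = 2 b. The count and p = a^2 + b^2 force a = 1 modulo 4 and b = 2 modulo 8.
    Hence (b - 2) / 4 is even and (- b - 2) / 4 is odd, so the sign in the conclusion turns either
    choice y = b or y = -b into b. *)
Lemma jacobsthal_arith_5mod8 (p : nat) (J G T x y : int) :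
  prime p -> (p = 5 %[mod 8])%N -> J ^+ 2 + G ^+ 2 = 4 * p%:Z ->
  16 * (2 * T + 1) = p%:Z + 1 + J + 2 * G ->
  p%:Z = x ^+ 2 + y ^+ 2 -> ~~ (2 %| x)%Z ->
  ((4 %| x - 1)%Z -> J = 2 * x) /\ G = (if (2 %| ((y - 2) %/ 4)%Z)%Z then 1 else -1) * (2 * y).
Proof.
move=> p_prime p8 JG JT pxy x4.
have [r pr] : exists r : int, p%:Z = 8 * r + 5 by exists (p %/ 8)%N; lia.
have [a Ja] : exists a : int, J = 2 * a.
  by clear JG pxy; exists (J %/ 2)%Z; lia.
have [b [Gb pab]] := half_sum_sqr Ja JG.
have oa : ~~ (2 %| a)%Z by clear JG pxy pab; lia.
have [b1 bb1] : exists b1 : int, b = 2 * b1.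
  suff : ~~ ~~ (2 %| b)%Z by exists (b %/ 2)%Z; clear JG pxy pab; lia.
  have [z az] := odd_intP oa.
  apply/negP => /odd_intP[g bg]; move: pab; rewrite pr az bg.
  have -> : (2 * z + 1) ^+ 2 + (2 * g + 1) ^+ 2 = 2 * (2 * (z ^+ 2 + g ^+ 2 + z + g) + 1) by ring.
  by set u := _ + g; clearbody u; clear; lia.
have [a1 aa1] : exists a1 : int, a = 4 * a1 + 1.
  by clear JG pxy pab; exists ((a - 1) %/ 4)%Z; lia.
have [c bc] : exists c : int, b1 = 2 * c + 1.
  apply/odd_intP/negP => h; have [z bz] : exists z : int, b1 = 2 * z by exists (b1 %/ 2)%Z; clear -h; lia.
  move: pab; rewrite pr aa1 bb1 bz.
  have -> : (4 * a1 + 1) ^+ 2 + (2 * (2 * z)) ^+ 2 = 8 * (2 * a1 ^+ 2 + a1 + 2 * z ^+ 2) + 1 by ring.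
  by set u := 2 * _ + a1 + _; clearbody u; clear; lia.
have [c' cc'] : exists c', c = 2 * c'.
  suff : (2 %| c)%Z by exists (c %/ 2)%Z; clear JG pxy pab; lia.
  have h1 := dvd2_mul_succ c; have h2 := dvd2_mul_succ a1.
  have E1 : 2 * r = 4 * (c * (c + 1)) + 4 * (a1 * (a1 + 1)) - 2 * a1.
    apply: (@mulfI _ 4) => //; apply: (addIr 5).
    have -> : 4 * (2 * r) + 5 = 8 * r + 5 by ring.
    rewrite -pr pab aa1 bb1 bc; ring.
  move: h1 h2 E1; set u := c * _; set v := a1 * _; clearbody u v.
  by clear pxy pab JG; lia.
have sq : a ^+ 2 = x ^+ 2.
  by apply: (two_squares_unique p_prime _ pab pxy); clear JG pxy pab; lia.
split.
  move=> x41; move/eqP: sq; rewrite eqf_sqr => /orP[/eqP ax|/eqP ax]; first by rewrite Ja ax.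
  by clear JG pxy pab; lia.
have : y ^+ 2 = b ^+ 2 by apply: (addrI (x ^+ 2)); rewrite -pxy pab sq.
move/eqP; rewrite eqf_sqr => /orP[] /eqP ->.
  have -> : ((b - 2) %/ 4)%Z = 2 * c' by clear JG pxy pab; lia.
  by rewrite dvdz_mulr // mul1r Gb.
have -> : ((- b - 2) %/ 4)%Z = - (2 * c' + 1) by clear JG pxy pab; lia.
have -> : (2 %| - (2 * c' + 1))%Z = false by clear; lia.
by rewrite Gb; ring.
Qed.

(** * Primes congruent to 1 modulo 4 *)

Section OneModFour.
Variables (F : finFieldType) (n : nat).
Hypothesis card_4n : #|F| = (4 * n).+1.

Let F_odd : odd #|F|.
Proof. by rewrite card_4n; lia. Qed.

Let half2n : #|F|./2 = (n * 2)%N.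
Proof. by rewrite card_4n; lia. Qed.

Lemma exists_sqrtN1 : exists i : F, i ^+ 2 = -1.
Proof.
have [g qg] := exists_qcharN1 F_odd; exists (g ^+ n).
by rewrite -exprM -half2n -(qchar_expr F_odd) qg.
Qed.

Variable i : F.
Hypothesis i2 : i ^+ 2 = -1.

Lemma qchar_sqrtN1 : qchar i = (-1) ^+ n.
Proof.
rewrite /qchar (negbTE (i_neq0 i2)) half2n mulnC exprM i2 -[RHS]signr_odd -[(-1 : F) ^+ n]signr_odd.
by case: (odd n); rewrite /= ?expr0 ?expr1 ?eqxx ?(negbTE (neq_N1 F_odd)).
Qed.

(** 2 i = (1 + i)^2, so 2 and [i] have the same character. *)
Lemma qchar_two : qchar (2 : F) = (-1) ^+ n.
Proof.
have i0 := i_neq0 i2; have n2 := two_neq0 F_odd.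
have E : (1 + i) ^+ 2 = 2 * i by rewrite sqrrD i2 expr1n; ring.
have nz : 1 + i != 0.
  by apply/eqP => z; move/eqP: E; rewrite z expr0n eq_sym mulf_eq0 (negbTE n2) (negbTE i0).
have := qchar_sqr F_odd nz; rewrite E (qcharM F_odd) -qchar_sqrtN1.
by case: (qchar_cases n2) => ->; case: (qchar_cases i0) => ->.
Qed.

Lemma two_expr_2n : (2 : F) ^+ (n * 2) = (-1) ^+ n.
Proof. by rewrite -half2n -(qchar_expr F_odd) qchar_two rmorphXn. Qed.

(** The coset is that of the fourth powers themselves ([e = 1], [s = 1]): it contains 1, whence the
    term 8, and contains 1/2 exactly when it contains 2. *)
Lemma jacobsthal_count_1mod8 : ~~ odd n -> exists T : int,
  16 * (2 * T + ((2 : F) ^+ n == 1)%:Z) + 8 = #|F|%:Z - 3 + 3 * jacobsthal (1 : F).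
Proof.
move=> /negbTE on.
have [T] := jacobsthal_count F_odd i2 (oner_neq0 F) card_4n (s := 1) (expr1n _ 2).
rewrite mulr1z !mul1r expr1n eqxx (qchar1 F) qchar_sqrtN1 -signr_odd on exprVn invr_eq1 => E.
by exists T; rewrite E; ring.
Qed.

(** For [e = 2] and [s = -1] the coset is that of 1/2, because (2^n)^2 = -1 gives 2^(-n) = -2^n. It
    does not contain 1, so the count is odd and the term 8 disappears. *)
Lemma jacobsthal_count_5mod8 : odd n -> exists T : int,
  16 * (2 * T + 1) = #|F|%:Z + 1 + jacobsthal (1 : F) + 2 * jacobsthal (2 : F).
Proof.
move=> on.
have [T] := jacobsthal_count F_odd i2 (two_neq0 F_odd) card_4n (s := -1) (sqrrN 1).
have e2 : (2 ^+ n) ^+ 2 = -1 :> F by rewrite -exprM two_expr_2n -signr_odd on.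
have n0 : 2 ^+ n != 0 :> F by rewrite expf_neq0 // two_neq0.
rewrite mulrN1z [-1 * 2 ^+ n]mulN1r exprVn.
have -> : (2 ^+ n)^-1 == - 2 ^+ n :> F.
  by rewrite -(inj_eq (mulfI n0)) divff // mulrN -expr2 e2 opprK.
have -> : (1 == - 2 ^+ n :> F) = false.
  apply/negP => /eqP E; move: e2; rewrite -sqrrN -E expr1n => /esym/eqP.
  by rewrite (negbTE (neq_N1 F_odd)).
rewrite qchar_two qchar_sqrtN1 -signr_odd on => E.
exists T; rewrite -[LHS]addr0 E; ring.
Qed.

End OneModFour.

(** * The two sums modulo p, and the case analysis on p *)

Section ReductionOfSums.
Variables (p : nat) (N : nat).
Hypotheses (p_prime : prime p) (p_odd : odd p) (N_lt : (N < p)%N).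
Hypothesis N_quarter : (4 * N + 1)%:R = 0 :> 'F_p.

Let card_p : #|'F_p| = p. Proof. exact: card_Fp. Qed.
Let F_odd : odd #|'F_p|. Proof. by rewrite card_p. Qed.

Lemma reduces_sqr_sum (z : rat) (zF : 'F_p) : reduces_to z zF ->
  reduces_to (\sum_(0 <= k < p) rat_binomial (- (1 / 4)) k ^+ 2 * z ^+ k)
             (\sum_(k < p) 'C(N, k)%:R ^+ 2 * zF ^+ k).
Proof.
move=> zz; apply: (reduces_sum (g := fun k => 'C(N, k)%:R ^+ 2 * zF ^+ k)) => k kp.
apply: reducesM; apply: reducesX => //; apply: reduces_binomial.
  exact: (natr_fact_neq0 p_prime card_p).
rewrite (natr_quarter F_odd N_quarter); apply: reducesN; apply: reducesM (reduces_nat _ 1) _.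
by apply: reducesV (reduces_nat _ 4); rewrite (natrM _ 2 2) mulf_neq0 // two_neq0.
Qed.

End ReductionOfSums.

Theorem theorem6p2 (p : nat) (p_prime : prime p) (p_odd : odd p) :
  let S1 : rat :=
    \sum_(0 <= k < p) rat_binomial (- (1 / 4)) k ^+ 2 * (- 8) ^+ k in
  let S2 : rat :=
    \sum_(0 <= k < p) rat_binomial (- (1 / 4)) k ^+ 2 * (1 / (- 8) ^+ k) in
  ((forall x y : int,
      p%:Z = x ^+ 2 + y ^+ 2 -> (p = 1 %[mod 4])%N -> (4 %| x - 1)%Z ->
      rat_eqmod p S1 ((-1) ^+ ((p - 1) %/ 4)%N * (2 * x)%:~R))
   /\ ((p = 3 %[mod 4])%N -> rat_eqmod p S1 0))
  /\
  ((forall x y : int,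
      p%:Z = x ^+ 2 + y ^+ 2 -> (p = 1 %[mod 8])%N -> (4 %| x - 1)%Z ->
      rat_eqmod p S2 ((-1) ^ (y %/ 4)%Z * (2 * x)%:~R))
   /\ (forall x y : int,
      p%:Z = x ^+ 2 + y ^+ 2 -> (p = 5 %[mod 8])%N -> ~~ (2 %| x)%Z ->
      rat_eqmod p S2 ((-1) ^ ((y - 2) %/ 4)%Z * (2 * y)%:~R))
   /\ ((p = 3 %[mod 4])%N -> rat_eqmod p S2 0)).
Proof.
move=> S1 S2.
pose F := 'F_p; have cardF : #|F| = p := card_Fp p_prime.
have F_odd : odd #|F| by rewrite cardF.
have p0 : p%:R = 0 :> F := pchar_Fp_0 p_prime.
have n2 : (2 : F) != 0 := two_neq0 F_odd.
have n8 : (-8 : F) != 0 by rewrite oppr_eq0 (natrM F 2 4) (natrM F 2 2) !mulf_neq0.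
pose s1 N : F := \sum_(k < p) 'C(N, k)%:R ^+ 2 * (-8) ^+ k.
pose s2 N : F := \sum_(k < p) 'C(N, k)%:R ^+ 2 * (-8)^-1 ^+ k.
have red N : (N < p)%N -> (4 * N + 1)%:R = 0 :> F ->
    [/\ reduces_to S1 (s1 N), reduces_to S2 (s2 N) & (-8) ^+ N * s2 N = s1 N].
  move=> Np N4; have r8 : reduces_to (-8) (-8 : F) := reduces_int F (-8).
  split; last exact: sum_bin_sqr_rev.
    exact: (reduces_sqr_sum p_prime p_odd N4 r8).
  have := reduces_sqr_sum p_prime p_odd N4 (reducesV n8 r8).
  congr reduces_to; apply: eq_bigr => k _.
  by rewrite [1 / _ ^+ k]div1r exprVn.
(* For p = 4 n + 1 the residue of -1/4 is [n] itself, and 3^m = 9^n cancels in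
   [sum_bin_sqr_quarter]. *)
have red1 n : p = (4 * n).+1 ->
    [/\ reduces_to S1 ((- jacobsthal (1 : F))%:~R : F),
        reduces_to S2 (2 ^+ n * (-1) ^+ n * - (jacobsthal (1 : F))%:~R : F)
      & #|F| = (4 * n).+1].
  move=> pn; have F4n : #|F| = (4 * n).+1 by rewrite cardF.
  have np : (n < p)%N by lia.
  have N4 : (4 * n + 1)%:R = 0 :> F by have -> : (4 * n + 1)%N = p by lia.
  have [r1 r2 r12] := red n np N4.
  have n3 : (3 : F) != 0.
    rewrite -(dvdn_pcharf (pchar_Fp p_prime)) dvdn_prime2 //; apply/eqP; lia.
  have half2n : #|F|./2 = (n * 2)%N by rewrite F4n; lia.
  have e1 : s1 n = - (jacobsthal (1 : F))%:~R.
    apply: (mulfI (expf_neq0 #|F|./2 n3)).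
    rewrite (sum_bin_sqr_quarter F_odd p_prime cardF np N4 n3) mulrN; congr (- (_ * _)).
    by rewrite half2n mulnC exprM; congr (_ ^+ _); ring.
  split=> //; first by rewrite rmorphN /= -e1.
  have -> : 2 ^+ n * (-1) ^+ n * - (jacobsthal (1 : F))%:~R = s2 n; last by [].
  rewrite -e1 -r12 mulrA -!exprMn.
  (* So 2^n (-1)^n is the inverse of (-8)^n, because 2^(4 n) = 1 by Fermat. *)
  have -> : 2 * -1 * -8 = 2 ^+ 4 :> F by ring.
  rewrite -exprM -[X in _ = X]mul1r; congr (_ * _).
  by apply: (mulfI n2); rewrite mulr1 -exprS -F4n expf_card.
have red3 : (p = 3 %[mod 4])%N -> rat_eqmod p S1 0 /\ rat_eqmod p S2 0.
  (* Here the residue of -1/4 is (3 p - 1) / 4. *)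
  move=> p3; have [N pN] : exists N, (3 * p = 4 * N + 1)%N by exists ((3 * p) %/ 4)%N; lia.
  have Np : (N < p)%N by lia.
  have N4 : (4 * N + 1)%:R = 0 :> F.
    by rewrite -pN natrM p0 mulr0.
  have [r1 r2 r12] := red N Np N4.
  suff e1 : s1 N = 0.
    have e2 : s2 N = 0.
      by move: r12; rewrite e1 => /eqP; rewrite mulf_eq0 expf_eq0 (negbTE n8) andbF => /eqP.
    by split; [move: r1; rewrite e1|move: r2; rewrite e2] => r;
      apply: reduces_eqmod p_prime r (reduces_int _ 0).
  (* The cubic identity cancels powers of 3, so p = 3 is computed directly: N = 2 and 1 - 4 * 8 + 64
     = 33. *)
  have [p_eq3|pn3] := eqVneq p 3%N.
    have N2 : N = 2%N by lia.
    have -> : s1 N = 33%:R.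
      rewrite /s1 (sum_ord_trunc (f := fun k => 'C(N, k)%:R ^+ 2 * (-8) ^+ k) Np); last first.
        by move=> k Nk; rewrite bin_small // expr0n mul0r.
      by rewrite N2 !big_ord_recr big_ord0 /= bin0 bin1 binn; ring.
    by have -> : 33%N = (p * 11)%N by [rewrite p_eq3]; rewrite natrM p0 mul0r.
  have n3 : (3 : F) != 0 by rewrite -(dvdn_pcharf (pchar_Fp p_prime)) dvdn_prime2.
  have := sum_bin_sqr_quarter F_odd p_prime cardF Np N4 n3.
  rewrite (jacobsthal_3mod4 F_odd) ?mulr0 ?oppr0; last by rewrite cardF; lia.
  by move/eqP; rewrite mulf_eq0 expf_eq0 (negbTE n3) andbF => /eqP.
have fin S (z : int) : reduces_to S (z%:~R : F) -> rat_eqmod p S z%:~R.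
  by move=> r; apply: reduces_eqmod p_prime r (reduces_int _ z).
have case1 x y : p%:Z = x ^+ 2 + y ^+ 2 -> (p = 1 %[mod 8])%N -> (4 %| x - 1)%Z ->
    rat_eqmod p S1 (2 * x)%:~R /\ rat_eqmod p S2 ((-1) ^ (y %/ 4)%Z * (2 * x)%:~R).
  move=> pxy p8 x4.
  have [n [pn on]] : exists n, p = (4 * n).+1 /\ ~~ odd n.
    by exists (p %/ 4)%N; clear -p8; lia.
  have [r1 r2 F4n] := red1 n pn; have [i i2] := exists_sqrtN1 F4n.
  have [T] := jacobsthal_count_1mod8 F4n i2 on; have [g qg] := exists_qcharN1 F_odd.
  have := jacobsthal_two_squares F_odd (qcharN1_sqrt F_odd i2) qg; rewrite cardF => JG JT.
  have [Jx y4] := jacobsthal_arith_1mod8 p_prime p8 JG JT pxy x4.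
  move: r1 r2; rewrite Jx !rmorphN !opprK -[(-1) ^+ n]signr_odd (negbTE on) mulr1 => r1 r2.
  split; first exact: fin.
  rewrite exprN1_int y4.
  (* 2 is a square as [n] is even, so 2^n is 1 or -1, and [y4] identifies which through the parity
     of y / 4. *)
  have /orP[/eqP e|/eqP e] : ((2 : F) ^+ n == 1) || ((2 : F) ^+ n == -1).
  - by rewrite -sqrf_eq1 -exprM (two_expr_2n F4n i2) -signr_odd (negbTE on).
  - by move: r2; rewrite e eqxx !mul1r; apply: fin.
  - by move: r2; rewrite e (negbTE (neq_N1 F_odd)) !mulN1r -!rmorphN; apply: fin.
have case5 x y : p%:Z = x ^+ 2 + y ^+ 2 -> (p = 5 %[mod 8])%N -> ~~ (2 %| x)%Z ->
    ((4 %| x - 1)%Z -> rat_eqmod p S1 (- (2 * x))%:~R) /\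
    rat_eqmod p S2 ((-1) ^ ((y - 2) %/ 4)%Z * (2 * y)%:~R).
  move=> pxy p8 ox.
  have [n [pn on]] : exists n, p = (4 * n).+1 /\ odd n.
    by exists (p %/ 4)%N; clear -p8; lia.
  have [r1 r2 F4n] := red1 n pn; have [i i2] := exists_sqrtN1 F4n.
  have [T] := jacobsthal_count_5mod8 F4n i2 on.
  have qg : qchar (2 : F) = -1 by rewrite (qchar_two F4n i2) -signr_odd on.
  have := jacobsthal_two_squares F_odd (qcharN1_sqrt F_odd i2) qg; rewrite cardF => JG JT.
  have [Jx Gy] := jacobsthal_arith_5mod8 p_prime p8 JG JT pxy ox.
  split; first by move=> x4; move: r1; rewrite (Jx x4); apply: fin.
  rewrite exprN1_int; move: r2.
  (* As [n] is odd, the second sum is 2^n J(1), which is J(2) modulo p; hence it involves y where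
     the first involves x. *)
  have -> : 2 ^+ n * (-1) ^+ n * - (jacobsthal (1 : F))%:~R = (jacobsthal (2 : F))%:~R :> F.
    rewrite (jacobsthal_modulo F_odd 2 F4n) -[(-1) ^+ n]signr_odd on; ring.
  by rewrite Gy; case: ifP => _ /fin; rewrite rmorphM.
split; [split|split; [|split]].
- move=> x y pxy p4 x4.
  have [p8|p8] : (p = 1 %[mod 8])%N \/ (p = 5 %[mod 8])%N by clear -p4; lia.
    have [r _] := case1 x y pxy p8 x4.
    rewrite -signr_odd; have -> : odd ((p - 1) %/ 4) = false by clear -p8; lia.
    by rewrite mul1r.
  have ox : ~~ (2 %| x)%Z by clear -x4; lia.
  have [r _] := case5 x y pxy p8 ox.
  rewrite -signr_odd; have -> : odd ((p - 1) %/ 4) by clear -p8; lia.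
  by rewrite mulN1r -rmorphN; apply: r.
- by case/red3.
- by move=> x y pxy p8 x4; case: (case1 x y pxy p8 x4).
- by move=> x y pxy p8 ox; case: (case5 x y pxy p8 ox).
- by case/red3.
Qed.
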